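(* Let $K=\{z=(z_1,z_2,z_3)\in\mathbb{R}^3: z_1,z_2,z_3\ge 0\}$ be the positive cone of $(\mathbb{R}^3,\|\cdot\|_3)$. Then $P_K$ is directionally differentiable on the whole space $(\mathbb{R}^3,\|\cdot\|_3)$ such that, for any $v=[v_i,v_j,v_k]\in\mathbb{R}^3$ with $v\ne\theta$ (and any distinct $i,j,k$ with $\{i,j,k\}=\{1,2,3\}$): (I) For $y=[y_i,y_j,y_k]\in K$: (i) for every $y\in K^o$, $P_K'(y)(v)=v$; (ii) for every $y=[y_i,y_j,0]\in\partial K$ with $y_i>0$, $y_j>0$: $P_K'(y)(v)=v$ if $v_k\ge0$, and $P_K'(y)(v)=[v_i,v_j,0]$ if $v_k<0$; (iii) for every $y=[y_i,0,0]\in\partial K$ with $y_i>0$: $P_K'(y)(v)=v$ if $v_j\ge0,v_k\ge0$; $P_K'(y)(v)=[v_i,v_j,0]$ if $v_j\ge0,v_k<0$; $P_K'(y)(v)=[v_i,0,0]$ if $v_j<0,v_k<0$; (iv) $P_K'(\theta)(v)=v$ if $v_i\ge0,v_j\ge0,v_k\ge0$; $P_K'(\theta)(v)=[v_i,v_j,0]$ if $v_i\ge0,v_j\ge0,v_k<0$; $P_K'(\theta)(v)=[v_i,0,0]$ if $v_i\ge0,v_j<0,v_k<0$; $P_K'(\theta)(v)=[0,0,0]$ if $v_i<0,v_j<0,v_k<0$. (II) For $x=[x_i,x_j,x_k]\in\mathbb{R}^3\setminus K$: (v) if $x_i>0,x_j>0,x_k<0$, then $P_K'(x)(v)=[v_i,v_j,0]$;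 (vi) if $x_i>0,x_j=0,x_k<0$, then $P_K'(x)(v)=[v_i,v_j,0]$ for $v_j\ge0,v_k<0$, and $P_K'(x)(v)=[v_i,0,0]$ for $v_j<0,v_k<0$; (vii) if $x_i=0,x_j=0,x_k<0$, then $P_K'(x)(v)=[v_i,v_j,0]$ for $v_i\ge0,v_j\ge0$; $P_K'(x)(v)=[v_i,0,0]$ for $v_i\ge0,v_j<0$; $P_K'(x)(v)=[0,0,0]$ for $v_i<0,v_j<0$; (viii) if $x_i<0,x_j=0,x_k<0$, then $P_K'(x)(v)=[0,v_j,0]$ for $v_j\ge0$, and $P_K'(x)(v)=[0,0,0]$ for $v_j<0$; (ix) if $x_i<0,x_j<0,x_k<0$, then $P_K'(x)(v)=\theta$.
   Context: $\|z\|_3=(|z_1|^3+|z_2|^3+|z_3|^3)^{1/3}$ on $\mathbb{R}^3$; $(\mathbb{R}^3,\|\cdot\|_3)$ is uniformly convex and uniformly smooth; $\theta$ is the origin. $K^o$ and $\partial K$ are the interior and boundary of $K$. For distinct $i,j,k$ with $\{i,j,k\}=\{1,2,3\}$, the vector $z=(z_1,z_2,z_3)$ is formally rewritten $[z_i,z_j,z_k]$, i.e. $[a,b,c]$ is the vector whose $i$-th, $j$-th, $k$-th coordinates are $a,b,c$ respectively. $P_K:\mathbb{R}^3\to K$ is the metric projection with respect to $\|\cdot\|_3$: $\|x-P_K(x)\|_3\le\|x-z\|_3$ for all $z\in K$. $P_K$ is directionally differentiable at $x$ if for each $v\neq\theta$ the limit $P_K'(x)(v)=\lim_{t\downarrow0}\frac{P_K(x+tv)-P_K(x)}{t}$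 exists; it is directionally differentiable on the whole space if this holds at every $x$. *)

(* Defs.v *)
From HB Require Import structures.
From mathcomp Require Import all_boot all_order all_algebra.
From mathcomp Require Import all_classical all_reals all_analysis.
From mathcomp Require Import ring lra.

Set Implicit Arguments.
Unset Strict Implicit.
Unset Printing Implicit Defensive.

Import Order.TTheory GRing.Theory Num.Theory.
Import numFieldNormedType.Exports.
Local Open Scope classical_set_scope.
Local Open Scope ring_scope.

(* A copy of 'rV[R]_3 whose norm is the 3-norm: 'rV[R]_3 itself already
   carries the sup norm. *)
Definition l3 (R : realType) : Type := 'rV[R]_3.

HB.instance Definition _ (R : realType) := GRing.Lmodule.copy (l3 R) 'rV[R]_3.

Definition l3norm (R : realType) (z : l3 R) : R :=
  (\sum_(l < 3) `|z 0 l| ^+ 3) `^ 3^-1.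

Section L3Norm.
Variable R : realType.
Implicit Types (x y : l3 R) (a b p q : R).

Let sum_ge0 x : 0 <= \sum_(l < 3) `|x 0 l| ^+ 3.
Proof. by apply: sumr_ge0 => l _; rewrite exprn_ge0. Qed.

Lemma l3norm_ge0 x : 0 <= l3norm x.
Proof. exact: powR_ge0. Qed.

Lemma l3norm_cube x : l3norm x ^+ 3 = \sum_(l < 3) `|x 0 l| ^+ 3.
Proof.
by rewrite -powR_mulrn ?l3norm_ge0// /l3norm -powRrM mulVf// powRr1.
Qed.

Lemma l3norm_eq0 x : l3norm x = 0 -> x = 0.
Proof.
move=> x0; have /esym/eqP := l3norm_cube x; rewrite x0 expr0n/=.
rewrite psumr_eq0 => [/allP h|l _]; last by rewrite exprn_ge0.
apply/rowP => l; have := h l; rewrite mem_index_enum => /(_ isT).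
by rewrite expf_eq0/= normr_eq0 => /eqP ->; rewrite mxE.
Qed.

Lemma l3normZ a x : l3norm (a *: x) = `|a| * l3norm x.
Proof.
apply: (@pexpIrn _ 3) => //; rewrite ?nnegrE ?mulr_ge0 ?l3norm_ge0//.
rewrite exprMn !l3norm_cube mulr_sumr; apply: eq_bigr => l _.
by rewrite mxE normrM exprMn.
Qed.

Let cube_convex a b p q : 0 < a -> 0 < b -> 0 <= p -> 0 <= q ->
  (p + q) ^+ 3 <= (a + b) ^+ 2 * (p ^+ 3 / a ^+ 2 + q ^+ 3 / b ^+ 2).
Proof.
move=> a0 b0 p0 q0; rewrite -subr_ge0.
have -> : (a + b) ^+ 2 * (p ^+ 3 / a ^+ 2 + q ^+ 3 / b ^+ 2) - (p + q) ^+ 3 =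
  (p * b - q * a) ^+ 2 * (p * b * (2 * a + b) + q * a * (a + 2 * b))
  / (a ^+ 2 * b ^+ 2).
  by field; rewrite !gt_eqF.
have a0' := ltW a0; have b0' := ltW b0.
apply: divr_ge0; last by apply: mulr_ge0; exact: sqr_ge0.
apply: mulr_ge0; first exact: sqr_ge0.
by apply: addr_ge0; apply: mulr_ge0; rewrite ?mulr_ge0//; lra.
Qed.

Lemma ler_l3normD x y : l3norm (x + y) <= l3norm x + l3norm y.
Proof.
have [x0|x0] := eqVneq (l3norm x) 0; first by
  rewrite (l3norm_eq0 x0) add0r lerDr l3norm_ge0.
have [y0|y0] := eqVneq (l3norm y) 0; first by
  rewrite (l3norm_eq0 y0) addr0 lerDl l3norm_ge0.
have xp : 0 < l3norm x by rewrite lt_def x0 l3norm_ge0.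
have yp : 0 < l3norm y by rewrite lt_def y0 l3norm_ge0.
rewrite -(@ler_pXn2r _ 3)// ?nnegrE ?addr_ge0 ?l3norm_ge0//.
rewrite l3norm_cube.
have -> : (l3norm x + l3norm y) ^+ 3 = (l3norm x + l3norm y) ^+ 2 *
    (l3norm x ^+ 3 / l3norm x ^+ 2 + l3norm y ^+ 3 / l3norm y ^+ 2).
  by field; rewrite x0 y0.
rewrite !(l3norm_cube, mulr_suml) -big_split mulr_sumr ler_sum//= => l _.
apply: le_trans (cube_convex xp yp (normr_ge0 _) (normr_ge0 _)).
by rewrite lerXn2r// ?nnegrE ?addr_ge0// mxE ler_normD.
Qed.

End L3Norm.

HB.instance Definition _ (R : realType) := Lmodule_isNormed.Build R (l3 R)
  (@ler_l3normD R) (@l3normZ R) (@l3norm_eq0 R).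

Section MetricProjection.
Variables (R : realType) (V : normedModType R).

(* A choice of nearest point: meaningful when the set below is a singleton, as
   for K closed, convex and nonempty in a uniformly convex Banach space. *)
Definition metric_proj (K : set V) (x : V) : V :=
  get [set p | K p /\ forall z, K z -> `|x - p| <= `|x - z|].

End MetricProjection.

(* One-sided versions of [derivable] and [derive]. *)
Section DirectionalDerivative.
Variables (R : realType) (V W : normedModType R).
Implicit Types (f : V -> W) (x v : V).

Definition dir_derivable f x v :=
  cvg (t^-1 *: (f (x + t *: v) - f x) @[t --> 0^'+]).

Definition dir_derive f x v : W :=
  lim (t^-1 *: (f (x + t *: v) - f x) @[t --> 0^'+]).

Definition dir_differentiable f x :=
  forall v, v != 0 -> dir_derivable f x v.

End DirectionalDerivative.

Definition boundary (T : topologicalType) (A : set T) : set T :=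
  closure A `\` A°.

Definition positive_cone (R : realType) : set (l3 R) :=
  [set z | forall l, 0 <= z 0 l].

(* The vector [a, b, c] whose i-th, j-th and k-th coordinates are a, b and c;
   meaningful only for pairwise distinct i, j, k. *)
Definition vec3 (R : realType) (i j k : 'I_3) (a b c : R) : l3 R :=
  a *: delta_mx 0 i + b *: delta_mx 0 j + c *: delta_mx 0 k.

(* Main.v *)
Require Import Defs.
From HB Require Import structures.
From mathcomp Require Import all_boot all_order all_algebra.
From mathcomp Require Import all_classical all_reals all_analysis.
From mathcomp Require Import lra.
Import Order.TTheory GRing.Theory Num.Theory.
Import numFieldNormedType.Exports.
Local Open Scope classical_set_scope.
Local Open Scope ring_scope.

(** The cube of the norm is a sum of one term per coordinate, and the positive
cone is a product of half-lines, so that the nearest point is computed one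
coordinate at a time: the metric projection replaces every coordinate [a] by
its positive part [max a 0] ([metric_proj_positive_cone]). The positive part is
piecewise linear: along a half-line [a + t * b] its difference quotient does not
depend on [t] once [t > 0] is small, and its value [pos_part_slope a b] is [b],
[max b 0] or [0] according as [a] is positive, zero or negative
([pos_part_quotient]). The difference quotient of the projection is therefore
itself constant for small [t > 0] ([cone_proj_quotient]), which gives both the
existence of the limit and its value, in whichever norm the limit is taken. The
cases of the theorem are instances of one formula, written in permuted
coordinates ([dir_derive_vec3]). *)

Definition pos_part {R : realType} (x : l3 R) : l3 R :=
  \row_l Num.max (x 0 l) 0.

(** The one-sided derivative at [a], in the direction [b], of the positive
part. *)
Definition pos_part_slope {R : realType} (a b : R) : R :=
  if a == 0 then Num.max b 0 else if 0 < a then b else 0.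

Lemma pos_part_slope_gt0 {R : realType} (a b : R) :
  0 < a -> pos_part_slope a b = b.
Proof. by move=> a0; rewrite /pos_part_slope gt_eqF// a0. Qed.

Lemma pos_part_slope_lt0 {R : realType} (a b : R) :
  a < 0 -> pos_part_slope a b = 0.
Proof. by move=> a0; rewrite /pos_part_slope lt_eqF// lt_gtF. Qed.

Lemma pos_part_slope0_ge0 {R : realType} (b : R) :
  0 <= b -> pos_part_slope 0 b = b.
Proof. by move=> b0; rewrite /pos_part_slope eqxx max_l. Qed.

Lemma pos_part_slope0_lt0 {R : realType} (b : R) :
  b < 0 -> pos_part_slope 0 b = 0.
Proof. by move=> b0; rewrite /pos_part_slope eqxx max_r// ltW. Qed.

Ltac slope := by [apply: pos_part_slope_gt0 | apply: pos_part_slope_lt0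
  | apply: pos_part_slope0_ge0 | apply: pos_part_slope0_lt0].

(** For [a != 0] the half-line keeps the sign of [a] as long as
[t * `|b| < `|a|]; for [a = 0] the positive part is positively homogeneous. *)
Lemma pos_part_quotient {R : realType} (a b : R) :
  \forall t \near 0^'+,
    t^-1 * (Num.max (a + t * b) 0 - Num.max a 0) = pos_part_slope a b.
Proof.
have [->|a0] := eqVneq a 0.
  near=> t; have t0 : 0 < t by near: t; exact: nbhs_right_gt.
  rewrite /pos_part_slope eqxx add0r maxxx subr0 maxr_pMr ?invr_ge0 ?ltW//.
  by rewrite mulr0 mulKf// gt_eqF.
have b1 : 0 < 1 + `|b| by rewrite ltr_pwDl.
have pos : 0 < `|a| / (1 + `|b|) by rewrite divr_gt0// normr_gt0.
near=> t; have t0 : 0 < t by near: t; exact: nbhs_right_gt.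
have tb : `|t * b| < `|a|.
  have : t < `|a| / (1 + `|b|) by near: t; exact: nbhs_right_lt.
  by rewrite ltr_pdivlMr// normrM (gtr0_norm t0); lra.
have := tb; rewrite ltr_norml => /andP[tbl tbr].
have [ap|an|/esym/eqP] := ltgtP 0 a; last by rewrite (negbTE a0).
- rewrite gtr0_norm// in tbl.
  rewrite pos_part_slope_gt0// !max_l; [|lra..].
  by rewrite addrC addKr mulKf// gt_eqF.
- rewrite ltr0_norm// in tbr.
  by rewrite pos_part_slope_lt0// !max_r ?subrr ?mulr0//; lra.
Unshelve. all: by end_near. Qed.

Lemma pos_part_nearest {R : realType} (a c : R) : 0 <= c ->
  `|a - Num.max a 0| <= `|a - c| ?= iff (c == Num.max a 0).
Proof.
move=> c0; have [a0|a0] := leP 0 a.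
  by rewrite subrr normr0; split => //; rewrite eq_sym normr_eq0 subr_eq0 eq_sym.
rewrite subr0 !ltr0_norm; [|lra..]; split; first lra.
by apply/eqP/eqP; lra.
Qed.

(** A nearest point cannot improve on the positive part in any coordinate, so
equality of the norms forces equality in every coordinate. *)
Lemma metric_proj_positive_cone {R : realType} (x : l3 R) :
  metric_proj (@positive_cone R) x = pos_part x.
Proof.
have cubes (z : l3 R) : positive_cone z ->
    `|x - pos_part x| <= `|x - z| ?= iff [forall l, z 0 l == pos_part x 0 l].
  (* The equality case is tracked along with the inequality, so that it passes
     from the coordinates to their sum. *)
  move=> z0; rewrite -(mono_in_leif (@ler_pXn2r R 3 isT)) ?nnegrE//.
  rewrite [_ ^+ 3]l3norm_cube [`|x - z| ^+ 3]l3norm_cube.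
  apply: leif_sum => l _.
  rewrite (mono_in_leif (@ler_pXn2r R 3 isT)) ?nnegrE// !mxE.
  exact: pos_part_nearest.
have K0 : positive_cone (pos_part x).
  by move=> l; rewrite mxE le_max lexx orbT.
rewrite /metric_proj; set N := [set p | _].
have : N (get N).
  by apply: (@getPex _ N); exists (pos_part x); split=> // z /cubes[].
move=> [gK /(_ _ K0) gmin]; apply/rowP => l; apply/eqP.
by have := ge_leif (cubes _ gK); rewrite gmin => /esym/forallP/(_ l).
Qed.

(** The three coordinates have finitely many thresholds in [t], so their
quotients are constant simultaneously. *)
Lemma cone_proj_quotient {R : realType} (x v : l3 R) :
  \forall t \near 0^'+,
    t^-1 *: (metric_proj (@positive_cone R) (x + t *: v)
             - metric_proj (@positive_cone R) x)
    = (\row_l pos_part_slope (x 0 l) (v 0 l) : l3 R).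
Proof.
have : \forall t \near 0^'+, forall l : 'I_3,
    t^-1 * (Num.max (x 0 l + t * v 0 l) 0 - Num.max (x 0 l) 0)
    = pos_part_slope (x 0 l) (v 0 l).
  by apply: filter_forall => l; exact: pos_part_quotient.
apply: filterS => t ht; rewrite !metric_proj_positive_cone.
by apply/rowP => l; rewrite !mxE ht.
Qed.

Lemma cone_proj_quotient_cvg {R : realType} (x v : l3 R) :
  t^-1 *: (metric_proj (@positive_cone R) (x + t *: v)
           - metric_proj (@positive_cone R) x) @[t --> 0^'+]
    --> (\row_l pos_part_slope (x 0 l) (v 0 l) : l3 R).
Proof. exact: cvg_near_cst (cone_proj_quotient x v). Qed.

(** An interior point can be moved a little against any basis vector without
leaving the cone, so the corresponding coordinate is at least the positive
length of the move. *)
Lemma interior_positive_cone_gt0 {R : realType} (y : l3 R) (l : 'I_3) :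
  (@positive_cone R)° y -> 0 < y 0 l.
Proof.
move=> Ky; pose e : l3 R := delta_mx 0 l.
have cv : y - t *: e @[t --> (0 : R)] --> y.
  rewrite -[X in _ --> X]subr0 -(scale0r e).
  by apply: cvgB; [exact: cvg_cst|apply: cvgZr_tmp; exact: cvg_id].
have : \forall t \near (0 : R)^'+, positive_cone (y - t *: e).
  by apply: cvg_within; exact: cv _ Ky.
move=> near_cone; near (0 : R)^'+ => t.
have t0 : 0 < t by near: t; exact: nbhs_right_gt.
have /(_ l) : positive_cone (y - t *: e) by near: t.
by rewrite !mxE !eqxx mulr1; lra.
Unshelve. all: by end_near. Qed.

Lemma vec3_1 {R : realType} {i j k : 'I_3} (a b c : R) :
  i != j -> i != k -> vec3 i j k a b c 0 i = a.
Proof. by move=> ij ik; rewrite !mxE !eqxx (negbTE ij) (negbTE ik) /=; lra. Qed.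

Lemma vec3_2 {R : realType} {i j k : 'I_3} (a b c : R) :
  i != j -> j != k -> vec3 i j k a b c 0 j = b.
Proof.
by move=> ij jk; rewrite !mxE !eqxx !(eq_sym j i) (negbTE ij) (negbTE jk) /=; lra.
Qed.

Lemma vec3_3 {R : realType} {i j k : 'I_3} (a b c : R) :
  i != k -> j != k -> vec3 i j k a b c 0 k = c.
Proof.
by move=> ik jk; rewrite !mxE !eqxx !(eq_sym k) (negbTE ik) (negbTE jk) /=; lra.
Qed.

Lemma vec3_000 {R : realType} (i j k : 'I_3) : vec3 i j k 0 0 0 = 0 :> l3 R.
Proof. by rewrite /vec3 !scale0r !addr0. Qed.

Lemma ord3_cases {i j k : 'I_3} (l : 'I_3) :
  i != j -> i != k -> j != k -> [\/ l = i, l = j | l = k].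
Proof.
move=> ij ik jk; have : l \in [set i; j; k]%SET.
  suff -> : [set i; j; k]%SET = [set: 'I_3]%SET by rewrite finset.in_setT.
  apply/eqP; rewrite eqEcard finset.subsetT cardsT card_ord.
  by rewrite finset.setUC cardsU1 cards2 !inE !(eq_sym k) negb_or ij ik jk.
by rewrite !inE => /orP[/orP[]|] /eqP ->; constructor.
Qed.

Lemma dir_derive_vec3 {R : realType} {i j k : 'I_3} (a b c a' b' c' : R) :
  i != j -> i != k -> j != k ->
  dir_derive (metric_proj (@positive_cone R))
    (vec3 i j k a b c) (vec3 i j k a' b' c')
  = vec3 i j k (pos_part_slope a a') (pos_part_slope b b')
      (pos_part_slope c c').
Proof.
move=> ij ik jk.
rewrite /dir_derive (norm_cvg_lim (cone_proj_quotient_cvg _ _)).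
apply/rowP => l; rewrite [LHS]mxE.
by case: (ord3_cases l ij ik jk) => ->; rewrite ?(vec3_1, vec3_2, vec3_3)//.
Qed.

Theorem proposition6p4 (R : realType) :
  let K : set (l3 R) := @positive_cone R in
  let P : l3 R -> l3 R := metric_proj K in
  (forall x : l3 R, dir_differentiable P x) /\
  forall (i j k : 'I_3), i != j -> i != k -> j != k ->
  let vec : R -> R -> R -> l3 R := vec3 i j k in
  forall vi vj vk : R, let v := vec vi vj vk in v != 0 ->
  (* (I) points of K *)
  [/\ (* (i) *)
      forall yi yj yk : R, let y := vec yi yj yk in
        K° y -> dir_derive P y v = v,
      (* (ii) *)
      forall yi yj : R, let y := vec yi yj 0 in
        boundary K y -> 0 < yi -> 0 < yj ->
        (0 <= vk -> dir_derive P y v = v) /\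
        (vk < 0 -> dir_derive P y v = vec vi vj 0),
      (* (iii) *)
      forall yi : R, let y := vec yi 0 0 in
        boundary K y -> 0 < yi ->
        [/\ 0 <= vj -> 0 <= vk -> dir_derive P y v = v,
            0 <= vj -> vk < 0 -> dir_derive P y v = vec vi vj 0 &
            vj < 0 -> vk < 0 -> dir_derive P y v = vec vi 0 0] &
      (* (iv) *)
      [/\ 0 <= vi -> 0 <= vj -> 0 <= vk -> dir_derive P 0 v = v,
          0 <= vi -> 0 <= vj -> vk < 0 -> dir_derive P 0 v = vec vi vj 0,
          0 <= vi -> vj < 0 -> vk < 0 -> dir_derive P 0 v = vec vi 0 0 &
          vi < 0 -> vj < 0 -> vk < 0 -> dir_derive P 0 v = vec 0 0 0]]
  /\
  (* (II) points outside K *)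
  forall xi xj xk : R, let x := vec xi xj xk in ~ K x ->
  [/\ (* (v) *)
      0 < xi -> 0 < xj -> xk < 0 -> dir_derive P x v = vec vi vj 0,
      (* (vi) *)
      0 < xi -> xj = 0 -> xk < 0 ->
        (0 <= vj -> vk < 0 -> dir_derive P x v = vec vi vj 0) /\
        (vj < 0 -> vk < 0 -> dir_derive P x v = vec vi 0 0),
      (* (vii) *)
      xi = 0 -> xj = 0 -> xk < 0 ->
        [/\ 0 <= vi -> 0 <= vj -> dir_derive P x v = vec vi vj 0,
            0 <= vi -> vj < 0 -> dir_derive P x v = vec vi 0 0 &
            vi < 0 -> vj < 0 -> dir_derive P x v = vec 0 0 0],
      (* (viii) *)
      xi < 0 -> xj = 0 -> xk < 0 ->
        (0 <= vj -> dir_derive P x v = vec 0 vj 0) /\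
        (vj < 0 -> dir_derive P x v = vec 0 0 0) &
      (* (ix) *)
      xi < 0 -> xj < 0 -> xk < 0 -> dir_derive P x v = 0].
Proof.
move=> K P; split.
  move=> x v _; apply/cvg_ex.
  by eexists; exact: cone_proj_quotient_cvg.
move=> i j k ij ik jk vec vi vj vk v _.
have slopes a b c a' b' c' : pos_part_slope a vi = a' ->
    pos_part_slope b vj = b' -> pos_part_slope c vk = c' ->
    dir_derive P (vec a b c) v = vec a' b' c'.
  by move=> <- <- <-; exact: dir_derive_vec3.
split.
  split=> [yi yj yk y Ky|yi yj y _ yi0 yj0|yi y _ yi0|].
  - have gt0 l : 0 < y 0 l by exact: interior_positive_cone_gt0.
    have := (gt0 i, gt0 j, gt0 k).
    rewrite !(vec3_1, vec3_2, vec3_3)//.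
    by move=> [[yi0 yj0] yk0]; apply: slopes; slope.
  - by split=> *; apply: slopes; slope.
  - by split=> *; apply: slopes; slope.
  - by rewrite -(vec3_000 i j k); split=> *; apply: slopes; slope.
move=> xi xj xk x _.
rewrite -(vec3_000 i j k).
split=> [xi0 xj0 xk0|xi0 xj0 xk0|xi0 xj0 xk0|xi0 xj0 xk0|xi0 xj0 xk0];
  rewrite /x ?xi0 ?xj0.
- by apply: slopes; slope.
- by split=> *; apply: slopes; slope.
- by split=> *; apply: slopes; slope.
- by split=> *; apply: slopes; slope.
- by apply: slopes; slope.
Qed.
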